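(* Let $m,n\ge1$. The data $\mathbb{M}_*$ described in the context is a module over $\mathbb{Y}_m^{op}\times\mathbb{Y}_n^{op}\times\mathbb{Y}_{m+n}$ (it satisfies all commuting relations), and the tensor product with it defines a functor from the category of $\mathbb{Y}_m\times\mathbb{Y}_n$-modules to the category of $\mathbb{Y}_{m+n}$-modules that is a categorification of the $*$ product, i.e. that induces at the level of Grothendieck groups the product $*:\mathrm{Dend}(m)\otimes\mathrm{Dend}(n)\to\mathrm{Dend}(m+n)$.
   Context: **Trees and Tamari order.** A planar binary tree is either a dot $\circ$ or a pair $(x\,y)$ of planar binary trees; its degree is its number of dots minus one; $\mathbb{Y}_n$ is the set of planar binary trees of degree $n\ge1$. The Tamari order on $\mathbb{Y}_n$: $x\le y$ if $x$ is obtained from $y$ by a sequence of local changes replacing a subtree $(a(bc))$ by $((ab)c)$, with $a,b,c$ planar binary trees, possibly dots. The over product $x/y$ replaces the leftmost dot of $y$ by $x$; the under product $x\backslash y$ replaces the rightmost dot of $x$ by $y$. **Modules.** A $\mathbb{Y}_n$-module is a finite-dimensional representation over $\mathbb{Q}$ of the Hasse diagram of $\mathbb{Y}_n$, with edges oriented decreasingly, satisfying all commutativity relations (equivalently a module over the incidence algebra); similarly for products of such posets and for $op$ (reversed arrows). The Grothendieck group of $\mathbb{Y}_n$-modules is identified with $\mathrm{Dend}(n)=\mathbb{Z}\mathbb{Y}_n$ by sending the simple module at $T$ to $T$; that of $\mathbb{Y}_m\times\mathbb{Y}_n$-modules is identified with $\mathrm{Dend}(m)\otimes\mathrm{Dend}(n)$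 by sending the simple at $(s,t)$ to $s\otimes t$. A functor $F$ induces a linear map $f$ on Grothendieck groups if $[F(N)]=f([N])$ for every module $N$. **Product.** $*$ is the bilinear (associative) product with $x*y=\sum_{x/y\le z\le x\backslash y}z$ for trees $x,y$. **The tri-module.** $\mathscr{P}(x)=\sum_{y\le x}y$. $\mathbb{M}_*$ has $\mathbb{Q}$ at each $(x,y,z)\in\mathbb{Y}_m\times\mathbb{Y}_n\times\mathbb{Y}_{m+n}$ such that $z$ occurs in $\mathscr{P}(x)*\mathscr{P}(y)$ and $0$ elsewhere; each arrow of the quiver $\mathbb{Y}_m^{op}\times\mathbb{Y}_n^{op}\times\mathbb{Y}_{m+n}$ (arrows change exactly one coordinate along an arrow of the corresponding factor) acts as the identity if its source and target both carry $\mathbb{Q}$, and as $0$ otherwise. The tensor product is taken over the incidence algebra of $\mathbb{Y}_m\times\mathbb{Y}_n$: $N\mapsto N\otimes_{\mathbb{Y}_m\times\mathbb{Y}_n}\mathbb{M}_*$. *)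

(* Defs.v *)
From HB Require Import structures.
From mathcomp Require Import all_boot all_order all_algebra zify.

Set Implicit Arguments.
Unset Strict Implicit.
Unset Printing Implicit Defensive.

Import Order.TTheory GRing.Theory.

Local Open Scope ring_scope.

Inductive tree : Type := Dot | Node of tree & tree.

Fixpoint tree_encode (t : tree) : GenTree.tree unit :=
  if t is Node a b then GenTree.Node 0 [:: tree_encode a; tree_encode b]
  else GenTree.Leaf tt.

Fixpoint tree_decode (g : GenTree.tree unit) : tree :=
  if g is GenTree.Node _ [:: a; b] then Node (tree_decode a) (tree_decode b)
  else Dot.

Lemma tree_encodeK : cancel tree_encode tree_decode.
Proof. by elim=> //= a -> b ->. Qed.

HB.instance Definition _ := Countable.copy tree (can_type tree_encodeK).

Fixpoint dots (t : tree) : nat :=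
  if t is Node a b then (dots a + dots b)%N else 1%N.

Definition degree (t : tree) : nat := (dots t).-1.

Lemma dots_gt0 t : (0 < dots t)%N.
Proof. by elim: t => //= a Ha b _; rewrite addn_gt0 Ha. Qed.

Record Y (n : nat) : Type := MkY { tree_of :> tree; _ : degree tree_of == n }.

HB.instance Definition _ n := [isSub for @tree_of n].
HB.instance Definition _ n := [Countable of Y n by <:].

(* Trees of height at most [h]; only used to show that [Y n] is finite. *)
Fixpoint trees_upto (h : nat) : seq tree :=
  if h is h'.+1 then
    Dot :: [seq Node a b | a <- trees_upto h', b <- trees_upto h']
  else [:: Dot].

Lemma trees_upto_mem h t : (dots t <= h.+1)%N -> t \in trees_upto h.
Proof.
have dotsS u : dots u = (dots u).-1.+1 by rewrite prednK ?dots_gt0.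
elim: h t => [|h IH] [|a b] // Hab; first by move: Hab; rewrite /= (dotsS a) (dotsS b) addnS.
rewrite inE; apply: allpairs_f; apply: IH; move: Hab => /=.
  by rewrite (dotsS b) addnS ltnS; apply: leq_trans; rewrite leq_addr.
by rewrite (dotsS a) addSn ltnS; apply: leq_trans; rewrite leq_addl.
Qed.

Definition Y_enum n : seq (Y n) := undup (pmap insub (trees_upto n)).

Lemma Y_enumP n : Finite.axiom (Y_enum n).
Proof.
move=> x; rewrite count_uniq_mem ?undup_uniq // mem_undup mem_pmap_sub.
rewrite trees_upto_mem //; case: x => t /= /eqP <-.
by rewrite /degree prednK ?dots_gt0.
Qed.

HB.instance Definition _ n := isFinite.Build (Y n) (@Y_enumP n).

(* The trees obtained from [t] by one replacement of a subtree (a(bc)) by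
   ((ab)c). *)
Fixpoint rotations (t : tree) : seq tree :=
  if t is Node a d then
    (if d is Node b c then [:: Node (Node a b) c] else [::])
      ++ [seq Node a' d | a' <- rotations a]
      ++ [seq Node a d' | d' <- rotations d]
  else [::].

Definition tamari_step n : rel (Y n) :=
  fun y x => tree_of x \in rotations (tree_of y).

Definition tamari_le n : rel (Y n) := fun x y => connect (@tamari_step n) y x.

(* Antisymmetry: each rotation increases the total number of dots lying in
   left subtrees. *)
Fixpoint left_dots (t : tree) : nat :=
  if t is Node a b then (dots a + left_dots a + left_dots b)%N else 0%N.

Lemma rotations_dots t u : u \in rotations t ->
  dots u = dots t /\ (left_dots t < left_dots u)%N.
Proof.
elim: t u => //= a IHa d IHd u; rewrite !mem_cat => /or3P[].
- case: d {IHd} => //= b c; rewrite inE => /eqP -> /=; rewrite addnA; split=> //.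
  by have := dots_gt0 a; lia.
- by case/mapP => a' /IHa[e l] -> /=; rewrite e ltn_add2r ltn_add2l.
- by case/mapP => d' /IHd[e l] -> /=; rewrite e ltn_add2l.
Qed.

Lemma tamari_le_left_dots n (x y : Y n) :
  tamari_le x y -> x = y \/ (left_dots y < left_dots x)%N.
Proof.
case/connectP=> p; elim: p y => [|z p IH] y /=; first by move=> _ ->; left.
case/andP=> /rotations_dots[_ l] pz ex; right.
by case: (IH z pz ex) => [->|] //; apply: ltn_trans.
Qed.

Lemma tamari_le_refl n : reflexive (@tamari_le n).
Proof. by move=> x; exact: connect0. Qed.

Lemma tamari_le_anti n : antisymmetric (@tamari_le n).
Proof.
move=> x y /andP[/tamari_le_left_dots[//|lxy] /tamari_le_left_dots[//|lyx]].
by have := ltn_trans lxy lyx; rewrite ltnn.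
Qed.

Lemma tamari_le_trans n : transitive (@tamari_le n).
Proof. by move=> y x z xy yz; exact: connect_trans yz xy. Qed.

Fact tamari_display : Order.disp_t. Proof. exact: Order.Disp tt tt. Qed.

HB.instance Definition _ n := Order.Le_isPOrder.Build tamari_display (Y n)
  (@tamari_le_refl n) (@tamari_le_anti n) (@tamari_le_trans n).

Fixpoint over_tree (x y : tree) : tree :=
  if y is Node a b then Node (over_tree x a) b else x.

Fixpoint under_tree (x y : tree) : tree :=
  if x is Node a b then Node a (under_tree b y) else y.

Lemma dots_over x y : dots (over_tree x y) = (dots x + dots y).-1.
Proof.
elim: y => [|a IHa b _] /=; first by rewrite addn1.
rewrite IHa addnA; have := dots_gt0 x.
by case: (dots x) => // k _; rewrite !addSn.
Qed.

Lemma dots_under x y : dots (under_tree x y) = (dots x + dots y).-1.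
Proof.
elim: x => [|a _ b IHb] //=; rewrite IHb -addnA; have := dots_gt0 b.
by case: (dots b) => // k _; rewrite addSn addnS.
Qed.

Lemma degree_over m n (x : Y m) (y : Y n) :
  degree (over_tree x y) == (m + n)%N.
Proof.
case: x y => [x /= /eqP <-] [y /= /eqP <-]; rewrite /degree dots_over.
by have := dots_gt0 x; have := dots_gt0 y; case: (dots x) (dots y) => [|p] [|q];
   rewrite //= addnS.
Qed.

Lemma degree_under m n (x : Y m) (y : Y n) :
  degree (under_tree x y) == (m + n)%N.
Proof.
case: x y => [x /= /eqP <-] [y /= /eqP <-]; rewrite /degree dots_under.
by have := dots_gt0 x; have := dots_gt0 y; case: (dots x) (dots y) => [|p] [|q];
   rewrite //= addnS.
Qed.

Definition over m n (x : Y m) (y : Y n) : Y (m + n) := MkY (degree_over x y).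
Definition under m n (x : Y m) (y : Y n) : Y (m + n) := MkY (degree_under x y).

Definition free_ab (T : finType) : zmodType := {ffun T -> int}.

Definition basis (T : finType) (t : T) : free_ab T := [ffun u => (u == t)%:R].

Definition Dend (n : nat) : zmodType := free_ab (Y n).

(* Tensor product of free groups, with basis the x (x) y for x : Y m and
   y : Y n. *)
Definition Dend2 (m n : nat) : zmodType := free_ab (Y m * Y n)%type.

Definition star m n (a : Dend m) (b : Dend n) : Dend (m + n) :=
  \sum_x \sum_y
    (\sum_(z | (over x y <= z <= under x y)%O) basis z) *~ (a x * b y).

(* The linear map on the tensor product defined by the bilinear map [star]. *)
Definition star_lin m n (d : Dend2 m n) : Dend (m + n) :=
  \sum_p star (basis p.1) (basis p.2) *~ d p.

(* The element written P(x) (script P). *)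
Definition down_sum n (x : Y n) : Dend n := \sum_(y | (y <= x)%O) basis y.

(* Finite quivers without multiple arrows or oriented cycles (the latter
   being expressed by a function decreasing along the arrows). *)
Record quiver : Type := Quiver {
  vertex :> finType;
  arrow : rel vertex;
  quiver_acyclic :
    exists r : vertex -> nat, forall x y, arrow x y -> (r y < r x)%N }.

(* There is an arrow x -> y in the Hasse diagram when x covers y. *)
Definition hasse_arrow d (P : finPOrderType d) : rel P :=
  fun x y => (y < x)%O && ~~ [exists z, (y < z < x)%O].

Lemma hasse_acyclic d (P : finPOrderType d) :
  exists r : P -> nat, forall x y, hasse_arrow x y -> (r y < r x)%N.
Proof.
exists (fun x => #|[pred z : P | (z < x)%O]|) => x y /andP[yx _].
apply/proper_card/properP; split.
  by apply/subsetP => z; rewrite !inE => zy; exact: lt_trans zy yx.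
by exists y; rewrite !inE ?ltxx.
Qed.

Definition hasse d (P : finPOrderType d) : quiver :=
  Quiver (@hasse_acyclic d P).

Definition op_arrow (Q : quiver) : rel Q := fun x y => arrow y x.

Lemma op_acyclic (Q : quiver) :
  exists r : Q -> nat, forall x y, op_arrow x y -> (r y < r x)%N.
Proof.
case: (quiver_acyclic Q) => r rQ; exists (fun x => \max_z r z - r x)%N => x y.
by move=> /rQ yx; apply: ltn_sub2l => //; apply: leq_trans yx (leq_bigmax y).
Qed.

Definition op_quiver (Q : quiver) : quiver := Quiver (@op_acyclic Q).

Definition prod_arrow (A B : quiver) : rel (A * B)%type := fun u v =>
  (arrow u.1 v.1 && (u.2 == v.2)) || ((u.1 == v.1) && arrow u.2 v.2).

Lemma prod_acyclic (A B : quiver) :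
  exists r : (A * B)%type -> nat,
    forall u v, prod_arrow u v -> (r v < r u)%N.
Proof.
case: (quiver_acyclic A) (quiver_acyclic B) => r rA [s sB].
exists (fun u => r u.1 + s u.2)%N => u v.
case/orP=> /andP[]; first by move=> /rA l /eqP ->; rewrite ltn_add2r.
by move=> /eqP -> /sB l; rewrite ltn_add2l.
Qed.

Definition prod_quiver (A B : quiver) : quiver := Quiver (@prod_acyclic A B).

Definition tamari (n : nat) : quiver := hasse (Y n).

(* Representations of the quiver, not assumed to satisfy any relation. *)
Record rep (Q : quiver) : Type := Rep {
  space :> Q -> vectType rat;
  act : forall x y : Q, arrow x y -> 'Hom(space x, space y) }.

Inductive qpath (Q : quiver) : Q -> Q -> Type :=
  | qnil x : qpath x x
  | qcons x y z : arrow x y -> qpath y z -> qpath x z.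

Fixpoint act_path (Q : quiver) (N : rep Q) (x y : Q) (w : qpath x y) :
    'Hom(N x, N y) :=
  match w with
  | qnil x => \1%VF
  | qcons x y z a w' => (act_path N w' \o act N a)%VF
  end.

Definition commuting (Q : quiver) (N : rep Q) : Prop :=
  forall (x y : Q) (w w' : qpath x y), act_path N w = act_path N w'.

Record module (Q : quiver) : Type := Module {
  rep_of :> rep Q;
  rep_commuting : commuting rep_of }.

Record hom (Q : quiver) (N N' : rep Q) : Type := Hom {
  hom_at :> forall x : Q, 'Hom(N x, N' x);
  hom_natural : forall (x y : Q) (a : arrow x y),
    (hom_at y \o act N a = act N' a \o hom_at x)%VF }.

Lemma id_natural (Q : quiver) (N : rep Q) (x y : Q) (a : arrow x y) :
  (\1 \o act N a = act N a \o \1)%VF.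
Proof. by rewrite comp_lfun1l comp_lfun1r. Qed.

Definition id_hom (Q : quiver) (N : rep Q) : hom N N :=
  Hom (@id_natural Q N).

Lemma comp_natural (Q : quiver) (N N' N'' : rep Q)
    (g : hom N' N'') (f : hom N N') (x y : Q) (a : arrow x y) :
  ((g y \o f y) \o act N a = act N'' a \o (g x \o f x))%VF.
Proof.
by rewrite -comp_lfunA hom_natural comp_lfunA hom_natural comp_lfunA.
Qed.

Definition comp_hom (Q : quiver) (N N' N'' : rep Q)
    (g : hom N' N'') (f : hom N N') : hom N N'' :=
  Hom (comp_natural g f).

Record functor (Q R : quiver) : Type := Functor {
  fobj :> module Q -> module R;
  fmap : forall N N' : module Q, hom N N' -> hom (fobj N) (fobj N');
  fmap_id : forall N : module Q, fmap (id_hom N) = id_hom (fobj N);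
  fmap_comp : forall (N N' N'' : module Q) (g : hom N' N'') (f : hom N N'),
    fmap (comp_hom g f) = comp_hom (fmap g) (fmap f) }.

Definition line (b : bool) : vectType rat :=
  if b then (rat^o : vectType rat) else ('rV[rat]_0 : vectType rat).

Definition line_map (b b' : bool) : 'Hom(line b, line b') :=
  match b, b' return 'Hom(line b, line b') with
  | true, true => \1%VF
  | _, _ => 0
  end.

Definition simple_rep (Q : quiver) (t : Q) : rep Q :=
  @Rep Q (fun x => line (x == t)) (fun x y _ => 0).

Lemma qpath_rank (Q : quiver) (r : Q -> nat) (x y : Q) :
  (forall x y : Q, arrow x y -> (r y < r x)%N) ->
  qpath x y -> (r y <= r x)%N.
Proof.
move=> rQ; elim=> [//|{}x {}y z a _ l].
exact: leq_trans l (ltnW (rQ _ _ a)).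
Qed.

Lemma simple_commuting (Q : quiver) (t : Q) : commuting (simple_rep t).
Proof.
have [r rQ] := quiver_acyclic Q.
have loop (x y : Q) (w : qpath x y) :
    (exists e : x = y, w = ecast y (qpath x y) e (qnil x)) \/
    ((r y < r x)%N /\ act_path (simple_rep t) w = 0).
  case: w => [{}x|{}x {}y z a w]; first by left; exists erefl.
  right; split; last by rewrite /= comp_lfun0r.
  exact: leq_ltn_trans (qpath_rank rQ w) (rQ _ _ a).
move=> x y w w'.
case: (loop x y w) (loop x y w') => [[e ->]|[l ->]] [[e' ->]|[l' ->]] //.
- by rewrite (eq_irrelevance e e').
- by exfalso; move: l'; rewrite e ltnn.
- by exfalso; move: l; rewrite e' ltnn.
Qed.

Definition simple (Q : quiver) (t : Q) : module Q :=
  Module (@simple_commuting Q t).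

Definition short_exact (Q : quiver) (A B C : module Q)
    (f : hom A B) (g : hom B C) : Prop :=
  forall x : Q,
    [/\ lker (f x) = 0%VS, limg (f x) = lker (g x) & limg (g x) = fullv].

Definition ses_additive (Q : quiver) (G : zmodType) (c : module Q -> G) : Prop :=
  forall (A B C : module Q) (f : hom A B) (g : hom B C),
    short_exact f g -> c B = c A + c C.

(* [G] is the abelian group generated by the [c N], subject to the relations
   given by the short exact sequences. *)
Definition grothendieck (Q : quiver) (G : zmodType) (c : module Q -> G) : Prop :=
  ses_additive c /\
  forall (H : zmodType) (h : module Q -> H), ses_additive h ->
    exists2 phi : {additive G -> H}, (forall N, phi (c N) = h N) &
      forall psi : {additive G -> H}, (forall N, psi (c N) = h N) -> psi =1 phi.

(* The identification of the Grothendieck group with the free abelian group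
   on the vertices; the second condition determines [c] uniquely. *)
Definition class_map (Q : quiver) (c : module Q -> free_ab Q) : Prop :=
  grothendieck c /\ forall t : Q, c (simple t) = basis t.

Definition induces (Q R : quiver) (F : functor Q R)
    (f : free_ab Q -> free_ab R) : Prop :=
  exists cQ : module Q -> free_ab Q, exists cR : module R -> free_ab R,
    [/\ class_map cQ, class_map cR & forall N, cR (F N) = f (cQ N)].

Lemma tensor_arrow (A B C : quiver) (p q : prod_quiver A B) (c : C) :
  arrow p q ->
  @arrow (prod_quiver (prod_quiver (op_quiver A) (op_quiver B)) C) (q, c) (p, c).
Proof.
move=> /= pq; apply/orP; left; rewrite /= eqxx andbT /=.
by case/orP: pq => /andP[h h']; apply/orP; [left|right];
   rewrite /= /op_arrow eq_sym ?h ?h'.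
Qed.

Lemma module_arrow (A B C : quiver) (p : prod_quiver A B) (c c' : C) :
  arrow c c' ->
  @arrow (prod_quiver (prod_quiver (op_quiver A) (op_quiver B)) C) (p, c) (p, c').
Proof. by move=> h; apply/orP; right; rewrite /= eqxx h. Qed.

Section Tensor.

Variables A B C : quiver.
Variable M : module (prod_quiver (prod_quiver (op_quiver A) (op_quiver B)) C).

(* A map (sum_p N p) x (sum_p M (p, c)) -> W which is bilinear and balanced
   over the incidence algebra of A x B.  This algebra is generated by the
   idempotents of the vertices, which force the components on N p x M (q, c)
   to vanish for p <> q, and by the arrows. *)
Definition balanced (N : rep (prod_quiver A B)) (c : C) (W : lmodType rat)
    (b : forall p : prod_quiver A B, N p -> M (p, c) -> W) : Prop :=
  [/\ forall p n, linear (b p n),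
      forall p m, linear (b p ^~ m)
    & forall (p q : prod_quiver A B) (a : arrow p q) (n : N p) (m : M (q, c)),
        b q (act N a n) m = b p n (act M (tensor_arrow c a) m)].

(* [b] exhibits T, a representation of C, as the tensor product of N by M. *)
Definition is_tensor (N : rep (prod_quiver A B)) (T : rep C)
    (b : forall (p : prod_quiver A B) (c : C), N p -> M (p, c) -> T c) : Prop :=
  [/\ forall c, balanced (fun p => b p c),
      forall (c : C) (W : lmodType rat)
          (g : forall p : prod_quiver A B, N p -> M (p, c) -> W), balanced g ->
        exists2 h : {linear T c -> W}, (forall p n m, h (b p c n m) = g p n m) &
          forall k : {linear T c -> W},
            (forall p n m, k (b p c n m) = g p n m) -> k =1 h
    & forall (p : prod_quiver A B) (c c' : C) (a : arrow c c')
          (n : N p) (m : M (p, c)),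
        act T a (b p c n m) = b p c' n (act M (module_arrow p a) m)].

Definition is_tensor_functor (F : functor (prod_quiver A B) C) : Prop :=
  exists b : forall (N : module (prod_quiver A B)) (p : prod_quiver A B) (c : C),
      N p -> M (p, c) -> F N c,
    (forall N, is_tensor (b N)) /\
    (forall (N N' : module (prod_quiver A B)) (f : hom N N')
        (p : prod_quiver A B) (c : C) (n : N p) (m : M (p, c)),
      fmap F f c (b N p c n m) = b N' p c (f p n) m).

End Tensor.

Definition trimod_quiver (m n : nat) : quiver :=
  prod_quiver (prod_quiver (op_quiver (tamari m)) (op_quiver (tamari n)))
    (tamari (m + n)).

Definition star_support (m n : nat) (u : (Y m * Y n) * Y (m + n)) : bool :=
  star (down_sum u.1.1) (down_sum u.1.2) u.2 != 0.

Definition Mstar (m n : nat) : rep (trimod_quiver m n) :=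
  @Rep (trimod_quiver m n) (fun u => line (star_support u))
    (fun u v _ => line_map (star_support u) (star_support v)).

(* Main.v *)
From HB Require Import structures.
From mathcomp Require Import all_boot all_order all_algebra zify.
From Stdlib Require Import ProofIrrelevance.
Require Import Defs.

(** Cutting a tree of degree m + n along the path from its dot number m to the
    root gives a monotone map [cut] from Y_(m+n) to Y_m x Y_n whose fibre over
    (x, y) is the interval from x/y to x\y.  Hence z occurs in P(x) * P(y) if
    and only if cut z <= (x, y): for fixed z, the trimodule is the indecomposable
    projective module at cut z, so that the tensor product by it is the pullback
    along [cut], N |-> (z |-> N (cut z)).  Classes in the Grothendieck group are
    dimension vectors, and pulling back the simple module at (x, y) gives the
    sum of the fibre of [cut] over (x, y), which is x * y. *)

Set Implicit Arguments.
Unset Strict Implicit.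
Unset Printing Implicit Defensive.

Import Order.TTheory GRing.Theory.

Local Open Scope ring_scope.

(** * Cutting trees *)

(** The Tamari order on bare trees, with no degree index: the inductions below pass to subtrees and
    pieces of other degrees. *)
Inductive rotation_le (x : tree) : tree -> Prop :=
  | rotation_le_refl : rotation_le x x
  | rotation_le_step y z :
      rotation_le x y -> y \in rotations z -> rotation_le x z.

Lemma rotation_le1 x y : x \in rotations y -> rotation_le x y.
Proof. by apply: rotation_le_step; exact: rotation_le_refl. Qed.

Lemma rotation_le_trans y x z :
  rotation_le x y -> rotation_le y z -> rotation_le x z.
Proof. by move=> xy; elim=> // u v _ xu; exact: rotation_le_step xu. Qed.

Lemma rotations_root a b c : Node (Node a b) c \in rotations (Node a (Node b c)).
Proof. by rewrite /= mem_head. Qed.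

Lemma rotations_Nodel a a' b :
  a' \in rotations a -> Node a' b \in rotations (Node a b).
Proof. by move=> h; rewrite /= !mem_cat (map_f (fun u => Node u b)) ?orbT. Qed.

Lemma rotations_Noder a b b' :
  b' \in rotations b -> Node a b' \in rotations (Node a b).
Proof. by move=> h; rewrite /= !mem_cat (map_f (Node a)) ?orbT. Qed.

Lemma rotation_le_Nodel a a' b :
  rotation_le a' a -> rotation_le (Node a' b) (Node a b).
Proof.
elim=> [|u v _ h uv]; first exact: rotation_le_refl.
exact: rotation_le_step h (rotations_Nodel _ uv).
Qed.

Lemma rotation_le_Noder a b b' :
  rotation_le b' b -> rotation_le (Node a b') (Node a b).
Proof.
elim=> [|u v _ h uv]; first exact: rotation_le_refl.
exact: rotation_le_step h (rotations_Noder _ uv).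
Qed.

Lemma tamari_leP n (x y : Y n) : (x <= y)%O <-> rotation_le x y.
Proof.
rewrite /Order.le /= /tamari_le; split.
  case/connectP=> p; elim: p y => [|z p IH] y /=.
    by move=> _ ->; exact: rotation_le_refl.
  by case/andP=> zy pz ex; exact: rotation_le_step (IH z pz ex) zy.
(* Induction needs a bare tree as index, so [y] is replaced by [w]. Rotations keep the number of
   dots, so every intermediate tree lies in [Y n]. *)
move=> h; have [w ew] : exists w : tree, w = y by exists y.
rewrite -ew in h; elim: h y ew => [|u v xu IH uv] y ey.
  by have -> : x = y by exact: val_inj.
have du : degree u == n.
  by rewrite /degree (rotations_dots uv).1 ey; exact: (valP y).
apply: (connect_trans _ (IH (MkY du) erefl)); apply: connect1.
by rewrite /tamari_step /= -ey.
Qed.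

(* The path from dot [k] to the root splits a tree in two; [cutl k] keeps the
   dots up to [k] and [cutr k] the dots from [k] on, numbered from 0. *)
Fixpoint cutl (k : nat) (t : tree) : tree :=
  if t is Node a b then
    if (k < dots a)%N then cutl k a else Node a (cutl (k - dots a) b)
  else Dot.

Fixpoint cutr (k : nat) (t : tree) : tree :=
  if t is Node a b then
    if (k < dots a)%N then Node (cutr k a) b else cutr (k - dots a) b
  else Dot.

Lemma dots_cutl k t : (k < dots t)%N -> dots (cutl k t) = k.+1.
Proof.
elim: t k => [|a IHa b IHb] k /=; first by case: k.
case: (ltnP k (dots a)) => [h _|h lt] /=; [exact: IHa|rewrite IHb; lia].
Qed.

Lemma dots_cutr k t : (k < dots t)%N -> dots (cutr k t) = (dots t - k)%N.
Proof.
elim: t k => [|a IHa b IHb] k /=; first by case: k.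
case: (ltnP k (dots a)) => [h _|h lt] /=; [rewrite IHa|rewrite IHb]; lia.
Qed.

Lemma cutl0 t : cutl 0 t = Dot.
Proof. by elim: t => //= a IHa b _; rewrite dots_gt0. Qed.

Lemma cutr0 t : cutr 0 t = t.
Proof. by elim: t => //= a IHa b _; rewrite dots_gt0 IHa. Qed.

Lemma dots_eqS t : dots t = (dots t).-1.+1.
Proof. by rewrite prednK ?dots_gt0. Qed.

Lemma cut_last t : cutl (dots t).-1 t = t /\ cutr (dots t).-1 t = Dot.
Proof.
elim: t => //= a _ b [IHl IHr]; rewrite (dots_eqS b) addnS /= ltnNge leq_addr /=.
by rewrite addKn IHl IHr.
Qed.

(** The dot is the last one of [x]: its path to the root climbs the right border of [x], then the
    left border of [y], and so separates the two. *)
Lemma cut_over x y :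
  cutl (dots x).-1 (over_tree x y) = x /\ cutr (dots x).-1 (over_tree x y) = y.
Proof.
elim: y => [|a [IHl IHr] b _] /=; first exact: cut_last.
have -> : ((dots x).-1 < dots (over_tree x a))%N.
  by rewrite dots_over; have := dots_gt0 x; have := dots_gt0 a; lia.
by rewrite IHl IHr.
Qed.

(** Here the same number designates the first dot of [y], whose path climbs the left border of [y],
    then the right border of [x]. *)
Lemma cut_under x y :
  cutl (dots x).-1 (under_tree x y) = x /\ cutr (dots x).-1 (under_tree x y) = y.
Proof.
elim: x => [|a _ b [IHl IHr]] /=; first by rewrite cutl0 cutr0.
by rewrite (dots_eqS b) addnS /= ltnNge leq_addr /= addKn IHl IHr.
Qed.

(** For a rotation (a(bc)) to ((ab)c) at the root, the dot [k] may lie in a, b or c: the right piece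
    is rotated in the first case, neither piece in the second, the left piece in the third. Deeper
    rotations follow by induction. *)
Lemma cut_rotations k t u : u \in rotations t ->
  rotation_le (cutl k u) (cutl k t) /\ rotation_le (cutr k u) (cutr k t).
Proof.
elim: t u k => //= a IHa d IHd u k; rewrite !mem_cat => /or3P[].
- case: d {IHd} => //= b c; rewrite inE => /eqP -> /=.
  (* If [k < dots a] the truncated difference is 0, and both sides hold because [b] has a dot. *)
  have -> : (k - dots a < dots b)%N = (k < dots a + dots b)%N.
    by have := dots_gt0 b; lia.
  rewrite subnDA; case: (ltnP k (dots a)) => ka.
    rewrite (leq_trans ka (leq_addr _ _)); split; first exact: rotation_le_refl.
    exact/rotation_le1/rotations_root.
  case: ifP => _; split; try exact: rotation_le_refl.
  exact/rotation_le1/rotations_root.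
- case/mapP => a' a'a -> /=; rewrite (rotations_dots a'a).1.
  have [hl hr] := IHa _ k a'a; case: ifP => _; split=> //.
  + exact: rotation_le_Nodel.
  + exact/rotation_le1/rotations_Nodel.
  + exact: rotation_le_refl.
- case/mapP => d' d'd -> /=.
  have [hl hr] := IHd _ (k - dots a)%N d'd; case: ifP => _; split=> //.
  + exact: rotation_le_refl.
  + exact/rotation_le1/rotations_Noder.
  + exact: rotation_le_Noder.
Qed.

Lemma cut_homo k t u : rotation_le u t ->
  rotation_le (cutl k u) (cutl k t) /\ rotation_le (cutr k u) (cutr k t).
Proof.
elim=> [|v w _ [IHl IHr] /(cut_rotations k)[hl hr]].
  by split; exact: rotation_le_refl.
by split; [exact: rotation_le_trans hl|exact: rotation_le_trans hr].
Qed.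

(** One rotation at each node of the left border of [y] carries [a] from the root down to [x]. *)
Lemma over_Nodel a x y :
  rotation_le (over_tree (Node a x) y) (Node a (over_tree x y)).
Proof.
elim: y => [|b IH c _] /=; first exact: rotation_le_refl.
apply: rotation_le_trans (rotation_le_Nodel _ IH) _.
exact/rotation_le1/rotations_root.
Qed.

Lemma under_Noder x y b :
  rotation_le (Node (under_tree x y) b) (under_tree x (Node y b)).
Proof.
elim: x => [|a _ c IH] /=; first exact: rotation_le_refl.
apply: rotation_le_trans (rotation_le_Noder _ IH).
exact/rotation_le1/rotations_root.
Qed.

(** Where the path enters a left subtree, the recursion of [over_tree] follows it; where it enters a
    right subtree, [over_Nodel] makes up the difference. [le_under_cut] is the mirror image. *)
Lemma over_cut_le k t : rotation_le (over_tree (cutl k t) (cutr k t)) t.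
Proof.
elim: t k => [|a IHa b IHb] k /=; first exact: rotation_le_refl.
case: ifP => _; first exact: rotation_le_Nodel.
exact: rotation_le_trans (over_Nodel _ _ _) (rotation_le_Noder _ (IHb _)).
Qed.

Lemma le_under_cut k t : rotation_le t (under_tree (cutl k t) (cutr k t)).
Proof.
elim: t k => [|a IHa b IHb] k /=; first exact: rotation_le_refl.
case: ifP => _; last exact: rotation_le_Noder.
exact: rotation_le_trans (rotation_le_Nodel _ (IHa _)) (under_Noder _ _ _).
Qed.

Lemma dotsY n (x : Y n) : dots x = n.+1.
Proof. by rewrite dots_eqS; congr _.+1; apply/eqP; exact: (valP x). Qed.

Lemma degree_cutl m n (z : Y (m + n)) : degree (cutl m z) == m.
Proof. by rewrite /degree dots_cutl // dotsY ltnS leq_addr. Qed.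

Lemma degree_cutr m n (z : Y (m + n)) : degree (cutr m z) == n.
Proof. by rewrite /degree dots_cutr dotsY ?ltnS ?leq_addr // -addnS addKn. Qed.

(** * The map [cut] and the coefficients of the product *)

Definition cut m n (z : Y (m + n)) : Y m * Y n :=
  (MkY (degree_cutl z), MkY (degree_cutr z)).

Lemma cut_le m n (z z' : Y (m + n)) : (z <= z')%O ->
  ((cut z).1 <= (cut z').1)%O /\ ((cut z).2 <= (cut z').2)%O.
Proof. by move/tamari_leP/(cut_homo m) => [hl hr]; split; exact/tamari_leP. Qed.

(** Both ends of the interval are cut into [(x, y)], so monotonicity and antisymmetry fix the cut of
    everything between them. The converse is [over_cut_le] and [le_under_cut]. *)
Lemma star_intervalE m n (x : Y m) (y : Y n) (z : Y (m + n)) :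
  (over x y <= z <= under x y)%O = (cut z == (x, y)).
Proof.
apply/idP/eqP => [/andP[/cut_le[xl yl] /cut_le[xu yu]]|ez].
  have [e1 e2] : cut (over x y) = (x, y) /\ cut (under x y) = (x, y).
    have [ol or_] := cut_over x y; have [ul ur] := cut_under x y.
    by rewrite dotsY in ol or_ ul ur; split; congr pair; apply: val_inj.
  move: xl yl xu yu; rewrite e1 e2 /= => xl yl xu yu.
  rewrite [cut z]surjective_pairing; congr pair; apply: le_anti.
    by rewrite xl xu.
  by rewrite yl yu.
have [ex1 ey1] : x = (cut z).1 /\ y = (cut z).2 by rewrite ez.
by apply/andP; split; apply/tamari_leP; rewrite ex1 ey1;
  [exact: over_cut_le|exact: le_under_cut].
Qed.

(** The intervals are the fibres of [cut], so exactly one pair of trees contributes to the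
    coefficient of [z]. *)
Lemma starE m n (a : Dend m) (b : Dend n) (z : Y (m + n)) :
  star a b z = a (cut z).1 * b (cut z).2.
Proof.
have coef x y :
    ((\sum_(u | (over x y <= u <= under x y)%O) basis u : Dend (m + n))
      *~ (a x * b y)) z = if cut z == (x, y) then a x * b y else 0.
  rewrite ffunMzE sum_ffunE -star_intervalE big_mkcond (bigD1 z) //= big1 => [|u uz].
    by rewrite ffunE eqxx addr0; case: ifP; rewrite ?mul0rz // intz.
  by rewrite ffunE eq_sym (negbTE uz) if_same.
move: (cut z) coef => c coef.
rewrite /star sum_ffunE (bigD1 c.1) //= sum_ffunE (bigD1 c.2) //=.
rewrite coef -surjective_pairing eqxx !big1 ?addr0 // => [x xz|y yz].
  rewrite sum_ffunE big1 // => y _; rewrite coef; case: eqP => // e.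
  by rewrite e eqxx in xz.
by rewrite coef; case: eqP => // e; rewrite e eqxx in yz.
Qed.

Lemma star_linE m n (d : Dend2 m n) z : star_lin d z = d (cut z).
Proof.
rewrite /star_lin sum_ffunE (bigD1 (cut z)) //= big1 ?addr0 => [|p pz];
  rewrite ffunMzE starE !ffunE.
  by rewrite !eqxx mulr1 intz.
by case: eqP => e1; case: eqP => e2; rewrite ?mul0r ?mulr0 ?mul0rz //;
  case/eqP: pz; rewrite [p]surjective_pairing -e1 -e2 -surjective_pairing.
Qed.

Lemma down_sumE n (x u : Y n) : down_sum x u = (u <= x)%O%:R.
Proof.
rewrite sum_ffunE big_mkcond (bigD1 u) //= big1 => [|y yu].
  by rewrite ffunE eqxx addr0; case: ifP.
by rewrite ffunE eq_sym (negbTE yu) if_same.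
Qed.

Lemma star_supportE m n (u : (Y m * Y n) * Y (m + n)) :
  star_support u = ((cut u.2).1 <= u.1.1)%O && ((cut u.2).2 <= u.1.2)%O.
Proof. by rewrite /star_support starE !down_sumE -natrM mulnb; case: (_ && _). Qed.

(** * Modules over a quiver *)

Lemma hom_inj (Q : quiver) (N N' : rep Q) (f g : hom N N') :
  hom_at f = hom_at g -> f = g.
Proof.
by case: f g => f fP [g gP] /= e; subst g; congr Hom; exact: proof_irrelevance.
Qed.

Lemma natural_path (Q : quiver) (N N' : rep Q) (f : hom N N') (x y : Q)
    (w : qpath x y) :
  (f y \o act_path N w = act_path N' w \o f x)%VF.
Proof.
elim: w => [z|{}x z {}y a w IH] /=; first by rewrite comp_lfun1l comp_lfun1r.
by rewrite comp_lfunA IH -comp_lfunA hom_natural comp_lfunA.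
Qed.

Lemma commuting_quotient (Q : quiver) (N N' : rep Q) (f : hom N N') :
  (forall x, limg (f x) = fullv) -> commuting N -> commuting N'.
Proof.
move=> fs cN x y w w'; apply/lfunP => v.
have /memv_imgP[u _ ->] : v \in limg (f x) by rewrite fs memvf.
by rewrite -!comp_lfunE -!natural_path (cN _ _ w w').
Qed.

(** * Paths and transport along them *)

Fixpoint qcat (Q : quiver) (x y z : Q) (w : qpath x y) : qpath y z -> qpath x z :=
  match w in qpath x y return qpath y z -> qpath x z with
  | qnil _ => id
  | qcons _ _ _ a w1 => fun w2 => qcons a (qcat w1 w2)
  end.

Lemma act_path_cat (Q : quiver) (N : rep Q) (x y z : Q) (w : qpath x y)
    (w' : qpath y z) :
  act_path N (qcat w w') = (act_path N w' \o act_path N w)%VF.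
Proof.
elim: w w' => [u|{}x u {}y a w IH] w' /=; first by rewrite comp_lfun1r.
by rewrite IH comp_lfunA.
Qed.

Lemma qpath_connect (Q : quiver) (x y : Q) : qpath x y -> connect (@arrow Q) x y.
Proof.
elim=> [z|{}x u {}y a _ uy]; first exact: connect0.
exact: connect_trans (connect1 a) uy.
Qed.

(** [qpath] lives in [Type] while connectedness is a boolean, so the path is extracted by
    [xchoose]. *)
Lemma connect_qpath (Q : quiver) (x y : Q) :
  connect (@arrow Q) x y -> qpath x y.
Proof.
move=> xy.
have ex : exists s, path (@arrow Q) x s && (last x s == y).
  by case/connectP: xy => s ps ->; exists s; rewrite ps eqxx.
have := xchooseP ex; move: (xchoose _) => s; elim: s x {xy ex} => [|z s IH] x /=.
  by move/eqP => <-; exact: qnil.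
by rewrite -andbA => /andP[xz /IH]; exact: qcons.
Qed.

(** The action of the incidence algebra element from [x] to [y]: along a chosen path, which does not
    matter in a module, and 0 by default when there is no path. *)
Definition transport (Q : quiver) (N : rep Q) (x y : Q) : 'Hom(N x, N y) :=
  if @idP (connect (@arrow Q) x y) is ReflectT xy
  then act_path N (connect_qpath xy) else 0.

Lemma transport_path (Q : quiver) (N : module Q) (x y : Q) (w : qpath x y) :
  transport N x y = act_path N w.
Proof.
rewrite /transport; case: {-}_ / idP => [xy|]; first exact: rep_commuting.
by case; exact: qpath_connect.
Qed.

Lemma transport_id (Q : quiver) (N : module Q) (x : Q) :
  transport N x x = \1%VF.
Proof. exact: transport_path (qnil x). Qed.

Lemma transport_arrow (Q : quiver) (N : module Q) (x y : Q) (a : arrow x y) :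
  transport N x y = act N a.
Proof. by rewrite (transport_path N (qcons a (qnil y))) /= comp_lfun1l. Qed.

Lemma transport_comp (Q : quiver) (N : module Q) (x y z : Q) :
  connect (@arrow Q) x y -> connect (@arrow Q) y z ->
  (transport N y z \o transport N x y)%VF = transport N x z.
Proof.
move=> /connect_qpath w /connect_qpath w'.
by rewrite (transport_path N w) (transport_path N w')
  (transport_path N (qcat w w')) act_path_cat.
Qed.

Lemma natural_transport (Q : quiver) (N N' : module Q) (f : hom N N') (x y : Q) :
  (f y \o transport N x y = transport N' x y \o f x)%VF.
Proof.
rewrite /transport; case: {-}_ / idP => [xy|_]; first exact: natural_path.
by rewrite comp_lfun0r comp_lfun0l.
Qed.

Definition linear_pack (R : nzRingType) (U V : lmodType R) (f : U -> V)
  (fL : linear f) : {linear U -> V} := HB.pack f (GRing.isLinear.Build R U V _ f fL).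

(** * Cokernels *)

Section Cokernel.

Variables (Q : quiver) (A B : module Q) (f : hom A B).

Let U x : {vspace B x} := limg (f x).

(** The quotient by the image is realized on a complement of it; [coker_lift] is the inclusion of
    that complement, a section of the projection. *)
Definition coker_map x : 'Hom(B x, subvs_of (U x)^C) :=
  (linfun (vsproj (U x)^C) \o (\1 - projv (U x)))%VF.
Definition coker_lift x : 'Hom(subvs_of (U x)^C, B x) := linfun vsval.

Lemma coker_mapE x v : coker_map x v = vsproj (U x)^C (v - projv (U x) v).
Proof.
by rewrite comp_lfunE [LHS]lfunE /= add_lfunE opp_lfunE id_lfunE.
Qed.

Lemma coker_mapK x v : coker_lift x (coker_map x v) = v - projv (U x) v.
Proof. by rewrite coker_mapE lfunE /= vsprojK // memv_projC. Qed.

Lemma coker_liftK x w : coker_map x (coker_lift x w) = w.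
Proof.
rewrite coker_mapE lfunE /=.
have /eqP -> : projv (U x) (vsval w) == 0.
  by rewrite -memv_ker lker_proj subvsP.
by rewrite subr0 vsvalK.
Qed.

Lemma lker_coker_map x : lker (coker_map x) = U x.
Proof.
apply/vspaceP => v; rewrite memv_ker; apply/eqP/idP => [v0|vU].
  have := coker_mapK v; rewrite v0 linear0 => /esym/eqP.
  by rewrite subr_eq0 => /eqP ->; exact: memv_proj.
by rewrite -[LHS]coker_liftK coker_mapK projv_id // subrr linear0.
Qed.

Definition coker_rep : rep Q :=
  @Rep Q (fun x => subvs_of (U x)^C)
    (fun x y a => (coker_map y \o act B a \o coker_lift x)%VF).

(** Lifting back changes a vector by an element of the image of [f]. Naturality of [f] keeps this
    element in the image after [act B a], where the projection kills it. *)
Lemma coker_natural x y (a : arrow x y) :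
  (coker_map y \o act B a = act coker_rep a \o coker_map x)%VF.
Proof.
apply/lfunP => v.
transitivity (coker_map y (act B a (coker_lift x (coker_map x v))));
  last by rewrite !comp_lfunE.
rewrite comp_lfunE coker_mapK !linearB /=.
have /memv_imgP[u _ eu] := memv_proj (U x) v.
have -> : act B a (projv (U x) v) = f y (act A a u).
  by rewrite eu -!comp_lfunE hom_natural.
suff /eqP -> : coker_map y (f y (act A a u)) == 0 by rewrite subr0.
by rewrite -memv_ker lker_coker_map memv_img ?memvf.
Qed.

Definition coker_hom : hom B coker_rep := @Hom Q B coker_rep coker_map coker_natural.

Lemma limg_coker_map x : limg (coker_map x) = fullv.
Proof.
apply/vspaceP => w; rewrite memvf; apply/memv_imgP.
by exists (coker_lift x w); rewrite ?memvf ?coker_liftK.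
Qed.

Definition coker : module Q :=
  Module (@commuting_quotient _ _ _ coker_hom limg_coker_map (@rep_commuting _ B)).

Lemma coker_short_exact :
  (forall x, lker (f x) = 0%VS) -> @short_exact _ A B coker f coker_hom.
Proof. by move=> f0 x; rewrite limg_coker_map lker_coker_map. Qed.

End Cokernel.

(** * Dimension vectors and simple submodules *)

Definition dim_vector (Q : quiver) (N : rep Q) : free_ab Q :=
  [ffun x => (\dim {:N x})%:Z].

Lemma dim_vector_additive (Q : quiver) :
  @ses_additive Q (free_ab Q) (fun N => dim_vector N).
Proof.
move=> A B C f g fg; apply/ffunP => x; rewrite !ffunE.
have [f0 fgx gs] := fg x.
rewrite -(limg_ker_dim (g x) fullv) capfv -fgx gs limg_dim_eq ?f0 ?capv0 //.
Qed.

(** Reading vectors as rationals lets elements of lines with different booleans be compared in one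
    type. *)
Definition line_val (b : bool) : 'Hom(line b, rat^o) :=
  if b return 'Hom(line b, rat^o) then \1%VF else 0.

Arguments line_val {b}.

Definition line_one (b : bool) : line b :=
  if b return line b then (1 : rat) else 0.

Lemma line_val_one b : line_val (line_one b) = b%:R.
Proof. by case: b; rewrite /= ?id_lfunE ?zero_lfunE. Qed.

Lemma line_valK (b : bool) (m : line b) : m = line_val m *: line_one b.
Proof.
case: b m => m /=; last by rewrite scaler0 [m]thinmx0 [RHS]thinmx0.
by rewrite id_lfunE; exact/esym/mulr1.
Qed.

Lemma line_val_inj (b : bool) : injective (@line_val b).
Proof. by move=> m m' e; rewrite [m]line_valK e -line_valK. Qed.

Lemma line_val0 (b : bool) (m : line b) : ~~ b -> line_val m = 0.
Proof. by case: b m => // m _; rewrite zero_lfunE. Qed.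

Lemma line_val_map (b b' : bool) m :
  (b -> b') -> line_val (line_map b b' m) = line_val m.
Proof.
case: b b' m => [] [] m /= bb'; rewrite ?id_lfunE ?zero_lfunE //.
by have := bb' isT.
Qed.

Lemma dim_line b : \dim {:line b} = b.
Proof. by case: b => /=; rewrite dimvf /dim /= ?mul0n. Qed.

Lemma dim_vector_simple (Q : quiver) (x : Q) : dim_vector (simple x) = basis x.
Proof. by apply/ffunP => y; rewrite !ffunE /= dim_line; case: eqP. Qed.

Section Socle.

Variables (Q : quiver) (N : module Q) (x : Q).
Hypothesis Nx_gt0 : (0 < \dim {:N x})%N.
Hypothesis N_below : forall y, arrow x y -> \dim {:N y} = 0%N.

Lemma socle_linear y :
  linear (fun s : line (y == x) => line_val s *: vpick {:N y}).
Proof. by move=> k s t; rewrite linearP scalerDl scalerA. Qed.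

(** At [x] this sends the generator to a nonzero vector of [N x]. Elsewhere the source is zero, so a
    uniform formula avoids casts along [y = x]. *)
Definition socle_map (y : Q) : 'Hom(line (y == x), N y) :=
  linfun (linear_pack (@socle_linear y)).

Lemma socle_mapE y s : socle_map y s = line_val s *: vpick {:N y}.
Proof. exact: lfunE. Qed.

Lemma socle_natural y z (a : arrow y z) :
  (socle_map z \o act (simple x) a = act N a \o socle_map y)%VF.
Proof.
apply/lfunP => s; rewrite !comp_lfunE zero_lfunE linear0 socle_mapE.
(* The test [y == x] occurs in the type of [s], hence a split on propositions. If [y = x], then [z]
   is the target of an arrow from [x] and [N z] is zero; otherwise [s] is zero. *)
have [yx|yx] : y = x \/ y != x by case: (eqVneq y x); [left|right].
  2: by rewrite (line_val0 _ yx) scale0r linear0.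
have z0 : \dim {:N z} = 0%N by apply: N_below; rewrite -yx.
move/eqP: z0; rewrite dimv_eq0 => /eqP z0.
by apply/esym/eqP; rewrite -memv0 -z0 memvf.
Qed.

Definition socle_hom : hom (simple x) N := @Hom Q (simple x) N socle_map socle_natural.

Lemma lker_socle y : lker (socle_map y) = 0%VS.
Proof.
apply/eqP; rewrite -subv0; apply/subvP => s.
rewrite memv_ker memv0 socle_mapE scaler_eq0.
have s0 : line_val s = 0 -> s == 0 by move=> e; rewrite [s]line_valK e scale0r.
have [yx|yx] : y = x \/ y != x by case: (eqVneq y x); [left|right].
  have Ny_gt0 : (0 < \dim {:N y})%N by rewrite yx.
  by rewrite vpick0 -dimv_eq0 eqn0Ngt Ny_gt0 orbF => /eqP/s0.
by rewrite s0 // line_val0.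
Qed.

End Socle.

(* A nonzero module has a simple submodule at any vertex of its support which
   is minimal for the arrows. *)
Lemma ses_additive_dim (Q : quiver) (G : zmodType) (h : module Q -> G) :
  ses_additive h ->
  forall N : module Q, h N = \sum_x h (simple x) *~ dim_vector N x.
Proof.
move=> hadd N; have [r rQ] := quiver_acyclic Q.
have [k le_k] := ubnP (\sum_x \dim {:N x})%N; elim: k => // k IH in N le_k *.
case: (pickP (fun x => 0 < \dim {:N x})%N) => [x0 Nx0|N0]; last first.
  have N00 x : \dim {:N x} = 0%N by apply/eqP; rewrite -leqn0 leqNgt N0.
  have sub0 x (U V : {vspace N x}) : U = V.
    have z W : W = 0%VS :> {vspace N x}.
      by apply/eqP; rewrite -dimv_eq0 -leqn0 -(N00 x) dimvS ?subvf.
    by rewrite (z U) (z V).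
  (* For a zero module the identities form a short exact sequence, so [h N = h N + h N] and [h N]
     vanishes. *)
  have /hadd/eqP : short_exact (id_hom N) (id_hom N) by move=> x; split; exact: sub0.
  rewrite -subr_eq0 opprD addNKr oppr_eq0 => /eqP ->.
  by rewrite big1 // => x _; rewrite ffunE N00.
(* Arrows decrease [r], so a support vertex of least [r] has only zero spaces at the ends of its
   arrows. The cokernel by the simple submodule there has total dimension one less. *)
case: (@arg_minnP _ x0 (fun x => 0 < \dim {:N x})%N r Nx0) => x Nx xmin.
have Nlow y : arrow x y -> \dim {:N y} = 0%N.
  by move=> /rQ ryx; apply/eqP; rewrite -leqn0 leqNgt; apply/negP => /xmin;
    rewrite leqNgt ryx.
have ses := coker_short_exact (f := socle_hom Nlow) (lker_socle Nx).
set C := coker _ in ses.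
have dimN := dim_vector_additive ses; rewrite dim_vector_simple in dimN.
rewrite (hadd _ _ _ _ _ ses) [in RHS]dimN (IH C).
  rewrite [RHS](eq_bigr (fun y =>
    h (simple y) *~ (y == x)%:R + h (simple y) *~ dim_vector C y)).
    rewrite [RHS]big_split /=; congr (_ + _).
    by rewrite (bigD1 x) //= eqxx mulr1z big1 ?addr0 // => y /negbTE ->.
  by move=> y _; rewrite -mulrzDr !ffunE.
have dims y : \dim {:N y} = ((y == x) + \dim {:C y})%N.
  by have /ffunP/(_ y) := dimN; rewrite !ffunE natz -PoszD => -[].
have sumN : (\sum_y \dim {:N y} = 1 + \sum_y \dim {:C y})%N.
  rewrite (eq_bigr _ (fun y _ => dims y)) big_split /=; congr (_ + _)%N.
  by rewrite -big_mkcond /= big_pred1_eq.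
by move: le_k; rewrite sumN.
Qed.

(** * Classes of modules *)

Definition linear_ext (T : finType) (G : zmodType) (g : T -> G) (d : free_ab T) : G :=
  \sum_t g t *~ d t.

Fact linear_ext_additive (T : finType) (G : zmodType) (g : T -> G) :
  zmod_morphism (linear_ext g).
Proof.
by move=> d e; rewrite /linear_ext -sumrB; apply: eq_bigr => t _; rewrite !ffunE mulrzBr.
Qed.

HB.instance Definition _ (T : finType) (G : zmodType) (g : T -> G) :=
  GRing.isZmodMorphism.Build (free_ab T) G (linear_ext g) (linear_ext_additive g).

Lemma additive_free_ab (T : finType) (G : zmodType) (psi : {additive free_ab T -> G})
    (d : free_ab T) :
  psi d = linear_ext (fun t => psi (basis t)) d.
Proof.
have {1}-> : d = linear_ext (@basis T) d.
  apply/ffunP => u; rewrite sum_ffunE (bigD1 u) //= big1 => [|t tu];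
    rewrite ffunMzE ffunE ?eqxx ?addr0 ?intz //.
  by rewrite eq_sym (negbTE tu) mul0rz.
by rewrite raddf_sum; apply: eq_bigr => t _; rewrite raddfMz.
Qed.

(** An additive invariant is determined by its values on simple modules, which gives the
    factorization; it is unique because simple modules have the basis elements as dimension
    vectors. *)
Lemma dim_vector_class (Q : quiver) :
  @class_map Q (fun N : module Q => dim_vector N).
Proof.
split; last exact: dim_vector_simple.
split=> [|G h hadd]; first exact: dim_vector_additive.
exists (linear_ext (fun x => h (simple x))) => [N|psi psiE d].
  by rewrite (ses_additive_dim hadd).
rewrite additive_free_ab; apply: eq_bigr => x _.
by rewrite -psiE dim_vector_simple.
Qed.

(** * Pullbacks and tensor products *)

Section Pullback.

Variables (Q R : quiver) (pi : R -> Q).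
Hypothesis pi_arrow : forall c c', arrow c c' -> connect (@arrow Q) (pi c) (pi c').

(** An arrow of [R] may go to a path of any length, even empty, so it acts by [transport]. *)
Definition pullback_rep (N : rep Q) : rep R :=
  @Rep R (fun c => N (pi c)) (fun c c' _ => transport N (pi c) (pi c')).

Lemma pi_connect c c' : connect (@arrow R) c c' -> connect (@arrow Q) (pi c) (pi c').
Proof.
move=> /connect_qpath; elim=> // {}c d e /pi_arrow cd _.
exact: connect_trans.
Qed.

Lemma pullback_path (N : module Q) c c' (w : qpath c c') :
  act_path (pullback_rep N) w = transport N (pi c) (pi c').
Proof.
elim: w => [d|{}c d {}c' a w IH] /=; first by rewrite transport_id.
rewrite IH transport_comp //; first exact: pi_arrow.
exact/pi_connect/qpath_connect.
Qed.

Lemma pullback_commuting (N : module Q) : commuting (pullback_rep N).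
Proof. by move=> c c' w w'; rewrite !pullback_path. Qed.

Definition pullback (N : module Q) : module R := Module (@pullback_commuting N).

Lemma pullback_natural (N N' : module Q) (f : hom N N') c c' (a : arrow c c') :
  (f (pi c') \o act (pullback N) a = act (pullback N') a \o f (pi c))%VF.
Proof. exact: (natural_transport f (pi c) (pi c')). Qed.

Definition pullback_hom (N N' : module Q) (f : hom N N') :
    hom (pullback N) (pullback N') :=
  @Hom R (pullback N) (pullback N') (fun c => f (pi c)) (pullback_natural f).

Lemma pullback_hom_id (N : module Q) :
  pullback_hom (id_hom N) = id_hom (pullback N).
Proof. exact: hom_inj. Qed.

Lemma pullback_hom_comp (N N' N'' : module Q) (g : hom N' N'') (f : hom N N') :
  pullback_hom (comp_hom g f) = comp_hom (pullback_hom g) (pullback_hom f).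
Proof. exact: hom_inj. Qed.

Definition pullback_functor : functor Q R :=
  Functor pullback_hom_id pullback_hom_comp.

End Pullback.

Section PullbackTensor.

Variables (A B C : quiver) (pi : C -> prod_quiver A B).
Let Q := prod_quiver A B.
Let MQ := prod_quiver (prod_quiver (op_quiver A) (op_quiver B)) C.
Hypothesis pi_arrow : forall c c', arrow c c' -> connect (@arrow Q) (pi c) (pi c').
Variable S : MQ -> bool.
Hypothesis SE : forall p c, S (p, c) = connect (@arrow Q) p (pi c).

(** For fixed [c] this is the indecomposable projective at [pi c]. The support [S] is a parameter,
    so that [Mstar] is an instance by conversion. *)
Definition indicator_rep : rep MQ :=
  @Rep MQ (fun u => line (S u)) (fun u v _ => line_map (S u) (S v)).

(** A reversed arrow of [Q] extends the path at its source, an arrow of [C] at its target. As the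
    support is closed under arrows, every arrow preserves [line_val], which yields the commuting
    relations. *)
Lemma indicator_arrow (u v : MQ) : arrow u v -> S u -> S v.
Proof.
case: u v => [p c] [q d]; rewrite !SE => /orP[] /= /andP[].
  move=> pq /eqP <-; apply: connect_trans; apply: connect1.
  case/orP: pq => /andP[h h']; apply/orP; [left|right];
    by rewrite eq_sym in h h' *; rewrite ?h ?h' //=; apply/andP.
move=> /eqP <- /pi_arrow cd pc; exact: connect_trans cd.
Qed.

Lemma indicator_act (u v : MQ) (a : arrow u v) (m : indicator_rep u) :
  line_val (act indicator_rep a m : line (S v)) = line_val (m : line (S u)).
Proof. exact/line_val_map/indicator_arrow. Qed.

Lemma indicator_commuting : commuting indicator_rep.
Proof.
have val_path (u v : MQ) (w : qpath u v) (m : indicator_rep u) :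
    line_val (act_path indicator_rep w m : line (S v)) = line_val (m : line (S u)).
  elim: w m => [x|{}u x {}v a w IH] m /=; first by rewrite id_lfunE.
  by rewrite comp_lfunE IH indicator_act.
by move=> u v w w'; apply/lfunP => m; apply: line_val_inj; rewrite !val_path.
Qed.

Definition indicator : module MQ := Module indicator_commuting.

Definition pairing (N : module Q) (p : Q) (c : C) (n : N p)
    (m : indicator (p, c)) : pullback pi_arrow N c :=
  line_val (m : line (S (p, c))) *: transport N p (pi c) n.

Lemma S_pi c : S (pi c, c). Proof. by rewrite SE connect0. Qed.

Definition generator c : indicator (pi c, c) := line_one (S (pi c, c)).

Lemma pairing_generator (N : module Q) c (n : N (pi c)) :
  pairing n (generator c) = n.
Proof. by rewrite /pairing line_val_one S_pi scale1r transport_id id_lfunE. Qed.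

Lemma indicator_act_one (u v : MQ) (a : arrow u v) :
  S u -> act indicator_rep a (line_one (S u)) = line_one (S v).
Proof.
move=> Su; apply: line_val_inj; rewrite indicator_act !line_val_one Su.
by rewrite (indicator_arrow a Su).
Qed.

(** The arrows of a path from [p] to [pi c] cross from one argument of [g] to the other one at a
    time, by balancedness. *)
Lemma balanced_path (N : module Q) c (W : lmodType rat)
    (g : forall p : Q, N p -> indicator (p, c) -> W) :
  balanced g -> forall (p : Q) (n : N p), S (p, c) ->
  g (pi c) (transport N p (pi c) n) (generator c) = g p n (line_one (S (p, c))).
Proof.
move=> [_ _ gact] p n Sp.
have w : qpath p (pi c) by apply: connect_qpath; rewrite -SE.
rewrite (transport_path N w) /generator.
(* The endpoint becomes an arbitrary [q] of the support, as induction on the path requires. *)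
have Sq : S (pi c, c) := S_pi c; move: (pi c) w Sq => q w Sq.
elim: w n Sq {Sp} => [x|{}p x {}q a w IH] n Sq /=; first by rewrite id_lfunE.
rewrite comp_lfunE IH // gact indicator_act_one //.
rewrite SE; apply: connect_trans (qpath_connect w) _; by rewrite -SE.
Qed.

Lemma balanced_pairing (N : module Q) c (W : lmodType rat)
    (g : forall p : Q, N p -> indicator (p, c) -> W) :
  balanced g -> forall (p : Q) (n : N p) (m : indicator (p, c)),
  g (pi c) (pairing n m) (generator c) = g p n m.
Proof.
move=> gB p n m; have [gl gr _] := gB.
have gr0 q (u : indicator (q, c)) : g q 0 u = 0.
  by have := gr q u (-1) 0 0; rewrite scaler0 addr0 scaleN1r addNr.
have gl0 q (u : N q) : g q u 0 = 0.
  by have := gl q u (-1) 0 0; rewrite scaler0 addr0 scaleN1r addNr.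
have grZ q (u : indicator (q, c)) k v : g q (k *: v) u = k *: g q v u.
  by have := gr q u k v 0; rewrite gr0 !addr0.
(* Off the support [m] is zero; on it, [m] is a multiple of [line_one]. *)
rewrite /pairing grZ; have [Sp|/negbNE Sp] := boolP (~~ S (p, c)).
  rewrite line_val0 // scale0r; suff -> : m = 0 by rewrite gl0.
  by apply: line_val_inj; rewrite line_val0 // linear0.
rewrite balanced_path //; have := gl p n (line_val m) (line_one (S (p, c))) 0.
by rewrite gl0 !addr0 -line_valK.
Qed.

(** A balanced [g] factors through its partial evaluation at [generator c]; uniqueness holds because
    pairing [n] with the generator gives back [n]. *)
Lemma pairing_tensor (N : module Q) : is_tensor (@pairing N).
Proof.
split=> [c|c W g gB|p c c' a n m].
- split=> [p n k m m'|p m k n n'|p q a n m]; rewrite /pairing.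
  + by rewrite linearP scalerDl scalerA.
  + by rewrite linearP scalerDr !scalerA mulrC.
  + rewrite indicator_act; have [Sq|/negbNE Sq] := boolP (~~ S (q, c)).
      by rewrite line_val0 ?scale0r.
    rewrite -(transport_arrow N a) -comp_lfunE transport_comp -?SE //.
    exact: connect1.
- have [_ gr _] := gB.
  have hL : linear (fun n : N (pi c) => g (pi c) n (generator c)).
    by move=> k n n'; exact: gr.
  exists (linear_pack hL) => [|k kg n] /=; first exact: balanced_pairing.
  by rewrite -[n in LHS]pairing_generator kg.
- rewrite /pairing indicator_act linearZ /=.
  have [Sp|/negbNE Sp] := boolP (~~ S (p, c)); first by rewrite line_val0 ?scale0r.
  congr (_ *: _); rewrite -comp_lfunE transport_comp //; last exact: pi_arrow.
  by rewrite -SE.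
Qed.

Lemma pullback_is_tensor_functor :
  is_tensor_functor indicator (pullback_functor pi_arrow).
Proof.
exists pairing; split=> [N|N N' f p c n m]; first exact: pairing_tensor.
rewrite /pairing linearZ /=; congr (_ *: _).
by rewrite -!comp_lfunE natural_transport.
Qed.

(* Both [F N c] and [N (pi c)] satisfy the universal property of the tensor
   product at [c]. *)
Lemma dim_tensor_functor (F : functor Q C) (N : module Q) c :
  is_tensor_functor indicator F -> \dim {:F N c} = \dim {:N (pi c)}.
Proof.
case=> b [/(_ N)[bB bU _] _]; have [pB _ _] := pairing_tensor N.
have [h hb _] := bU c _ _ (pB c).
have [_ br _] := bB c.
have kL : linear (fun n : N (pi c) => b N (pi c) c n (generator c)).
  by move=> k n n'; exact: br.
pose k : {linear N (pi c) -> F N c} := linear_pack kL.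
have hk n : h (k n) = n by rewrite /= hb pairing_generator.
have kh t : k (h t) = t.
  (* Both the composite and the identity factor [b] through itself, so uniqueness identifies
     them. *)
  have [u _ uU] := bU c _ _ (bB c).
  have kh_u : (k \o h)%FUN =1 u.
    by apply: uU => p n m; rewrite /= hb (balanced_pairing (bB c)).
  by have := kh_u t; rewrite /= -(uU idfun).
have lker_h : lker (linfun h) == 0%VS.
  by apply/lker0P => s t; rewrite !lfunE /= => e; rewrite -[s]kh e kh.
rewrite -(limg_dim_eq (f := linfun h)) ?(eqP lker_h) ?capv0 //.
congr (\dim _); apply/vspaceP => n; rewrite memvf; apply/memv_imgP.
by exists (k n); rewrite ?memvf // lfunE /= hk.
Qed.

End PullbackTensor.

(** * The Tamari case *)

Lemma hasse_connect d (P : finPOrderType d) (x y : P) :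
  connect (@hasse_arrow d P) x y = (y <= x)%O.
Proof.
apply/idP/idP => [/connectP[s]|].
  elim: s x => [|z s IH] x /= => [_ -> //|/andP[/andP[zx _] sz] e].
  exact: le_trans (IH z sz e) (ltW zx).
have [k] := ubnP #|[pred z : P | (z < x)%O]|; elim: k x => // k IH x le_k.
rewrite le_eqVlt => /orP[/eqP ->|yx]; first exact: connect0.
(* Among the elements of [y, x), one with the largest strict down-set is covered by [x]; it serves
   as the first vertex of the path. *)
case: (arg_maxnP (P := fun z => (y <= z < x)%O)
  (fun z => #|[pred u : P | (u < z)%O]|) (i0 := y)) => [|z /andP[yz zx] zmax].
  by rewrite lexx.
have below u v : (u < v)%O ->
    (#|[pred w : P | (w < u)%O]| < #|[pred w : P | (w < v)%O]|)%N.
  move=> uv; apply/proper_card/properP; split.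
    by apply/subsetP => w; rewrite !inE => /lt_trans; exact.
  by exists u; rewrite !inE ?ltxx.
apply: (@connect_trans _ _ z); last by apply: IH yz; exact: leq_trans (below _ _ zx) _.
apply: connect1; rewrite /hasse_arrow zx; apply/existsPn => u; apply/negP => /andP[zu ux].
have /zmax : (y <= u < x)%O by rewrite ux (le_trans yz (ltW zu)).
by rewrite /geq /= leqNgt below.
Qed.

(** Paths in the two factors combine by moving the first coordinate all the way, then the second. *)
Lemma prod_connect (A B : quiver) (p q : prod_quiver A B) :
  connect (@arrow (prod_quiver A B)) p q =
    connect (@arrow A) p.1 q.1 && connect (@arrow B) p.2 q.2.
Proof.
apply/idP/andP => [/connect_qpath|[]].
  elim=> [x|x y z a _ [c1 c2]]; first by split; exact: connect0.
  case/orP: a => /andP[] => [a1 /eqP a2|/eqP a1 a2].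
    by rewrite a2; split=> //; exact: connect_trans (connect1 a1) c1.
  by rewrite a1; split=> //; exact: connect_trans (connect1 a2) c2.
case: p q => [a b] [a' b'] /= /connect_qpath wa /connect_qpath wb.
apply: (@connect_trans _ _ (a', b)).
  elim: wa => [x|x y z xy _]; first exact: connect0.
  by apply: connect_trans; apply: connect1; rewrite /= /prod_arrow /= xy eqxx.
elim: wb => [x|x y z xy _]; first exact: connect0.
by apply: connect_trans; apply: connect1; rewrite /= /prod_arrow /= xy eqxx orbT.
Qed.

Lemma tamari_prod_connect m n (p q : Y m * Y n) :
  connect (@arrow (prod_quiver (tamari m) (tamari n))) p q =
    (q.1 <= p.1)%O && (q.2 <= p.2)%O.
Proof. by rewrite prod_connect !hasse_connect. Qed.

Lemma cut_arrow m n (z z' : tamari (m + n)) : arrow z z' ->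
  connect (@arrow (prod_quiver (tamari m) (tamari n))) (cut z) (cut z').
Proof.
by case/andP=> /ltW/cut_le[c1 c2] _; rewrite tamari_prod_connect c1 c2.
Qed.

Lemma star_support_connect m n (p : Y m * Y n) (z : Y (m + n)) :
  star_support (p, z) =
    connect (@arrow (prod_quiver (tamari m) (tamari n))) p (cut z).
Proof. by rewrite star_supportE tamari_prod_connect. Qed.

Theorem mainTheorem4 (m n : nat) (hm : (1 <= m)%N) (hn : (1 <= n)%N) :
  exists hM : commuting (Mstar m n),
    (exists F : functor (prod_quiver (tamari m) (tamari n)) (tamari (m + n)),
       is_tensor_functor (Module hM) F) /\
    (forall F : functor (prod_quiver (tamari m) (tamari n)) (tamari (m + n)),
       is_tensor_functor (Module hM) F -> induces F (@star_lin m n)).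
Proof.
(* [Mstar m n] is convertible to the indicator representation with support [star_support]. *)
exists (indicator_commuting (@cut_arrow m n) (@star_support_connect m n)).
split=> [|F tF].
  exists (pullback_functor (@cut_arrow m n)); exact: pullback_is_tensor_functor.
exists (fun N => dim_vector N), (fun N => dim_vector N).
split=> [||N]; try exact: dim_vector_class.
(* At [z] both sides are the dimension of [N] at [cut z]. *)
apply/ffunP => z; rewrite star_linE !ffunE.
by rewrite (dim_tensor_functor N z tF).
Qed.
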